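(* For every integer $k\geq1$, $\delta>0$, $\epsilon>0$ and function $\sigma\colon\mathbb{N}\to(0,1)$ there is $N=N(k,\delta,\epsilon,\sigma)$ such that for all finite nonempty sets $V,W$ and every $(k,\delta)$-stable function $f\colon V\times W\to[0,1]$ there are $m,n\leq N$ and a decomposition $f=f_{\mathrm{str}}+f_{\mathrm{psd}}+f_{\mathrm{err}}$ such that: (i) $f_{\mathrm{str}}$ is $(5\delta+\epsilon;m,n)$-structured; (ii) $|\operatorname{supp}(f_{\mathrm{psd}})|\leq\sigma(mn)|V\times W|$; (iii) $f_{\mathrm{err}}$ has $\epsilon$-structured support. Moreover, $f_{\mathrm{psd}}$ is $[-1,1]$-valued, $f_{\mathrm{str}}$ and $f_{\mathrm{err}}$ are $[0,1]$-valued, and $\langle f_{\mathrm{err}},f_{\mathrm{str}}\rangle=\langle f_{\mathrm{err}},|f_{\mathrm{psd}}|\rangle=0$.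
   Context: $f\colon V\times W\to\mathbb{R}$ is $(k,\delta)$-stable if there are no $a_1,\ldots,a_k\in V$, $b_1,\ldots,b_k\in W$ with $|f(a_i,b_j)-f(a_j,b_i)|\geq\delta$ for all $i<j$. For functions on a finite set $X$, $\langle g,h\rangle=\frac{1}{|X|}\sum_{x\in X}g(x)h(x)$ and $\|g\|_\infty=\max_x|g(x)|$. A function $g\colon V\times W\to[-1,1]$ is $(m,n)$-structured if it is of the form $\sum_{i,j}r_{i,j}\mathbf{1}_{V_i\times W_j}$ for some partitions $V=V_0\cup V_1\cup\ldots\cup V_m$, $W=W_0\cup W_1\cup\ldots\cup W_n$ (sum over pieces of the partitions) with $r_{i,j}\in[-1,1]$. A function $g\colon V\times W\to[0,1]$ is $(\delta;m,n)$-structured if there is an $(m,n)$-structured $h\colon V\times W\to[0,1]$ with $\|g-h\|_\infty\leq\delta$. A function $g\colon V\times W\to[-1,1]$ has $\epsilon$-structured support if $\operatorname{supp}(g)\subseteq(V_0\times W)\cup(V\times W_0)$ for some $V_0\subseteq V$, $W_0\subseteq W$ with $|V_0|\leq\epsilon|V|$ and $|W_0|\leq\epsilon|W|$. *)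

(* Defs.v *)
From HB Require Import structures.
From mathcomp Require Import all_boot all_order all_algebra.
From mathcomp Require Import reals.

Set Implicit Arguments.
Unset Strict Implicit.
Unset Printing Implicit Defensive.

Import Order.TTheory GRing.Theory Num.Theory.
Local Open Scope ring_scope.

Definition valued_in (R : realType) (X : Type) (a b : R) (g : X -> R) : Prop :=
  forall x, a <= g x <= b.

Definition inner (R : realType) (X : finType) (g h : X -> R) : R :=
  #|X|%:R^-1 * \sum_(x : X) g x * h x.

(* The base value 0 is harmless: all the terms are nonnegative. *)
Definition norm_inf (R : realType) (X : finType) (g : X -> R) : R :=
  \big[Num.max/0]_(x : X) `|g x|.

Definition stable (R : realType) (V W : finType) (k : nat) (delta : R)
    (f : V * W -> R) : Prop :=
  ~ exists (a : 'I_k -> V) (b : 'I_k -> W),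
      forall i j : 'I_k, (i < j)%N ->
        delta <= `|f (a i, b j) - f (a j, b i)|.

(* The pieces V_0, ..., V_m (resp. W_0, ..., W_n) are the members of P
   (resp. Q), whence the cardinals m + 1 and n + 1; as usual for [partition],
   they are nonempty. *)
Definition structured (R : realType) (V W : finType) (m n : nat)
    (g : V * W -> R) : Prop :=
  valued_in (-1) 1 g /\
  exists (P : {set {set V}}) (Q : {set {set W}}) (r : {set V} -> {set W} -> R),
    [/\ partition P [set: V] /\ #|P| = m.+1,
        partition Q [set: W] /\ #|Q| = n.+1,
        forall A B, A \in P -> B \in Q -> -1 <= r A B <= 1
      & forall x, g x =
          \sum_(A in P) \sum_(B in Q) r A B * (x \in setX A B)%:R].

Definition approx_structured (R : realType) (V W : finType) (delta : R)
    (m n : nat) (g : V * W -> R) : Prop :=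
  valued_in 0 1 g /\
  exists h : V * W -> R,
    [/\ structured m n h, valued_in 0 1 h & norm_inf (g \- h) <= delta].

Definition structured_support (R : realType) (V W : finType) (eps : R)
    (g : V * W -> R) : Prop :=
  valued_in (-1) 1 g /\
  exists (V0 : {set V}) (W0 : {set W}),
    [/\ support g \subset setX V0 [set: W] :|: setX [set: V] W0,
        #|V0|%:R <= eps * #|V|%:R
      & #|W0|%:R <= eps * #|W|%:R].

(* Main.v *)
(** Call a set [A] of rows good if, for every column [y], no two sets
    [{x in A | f x y <= s}] and [{x in A | s + 5/2 delta <= f x y}] both have
    measure at least [th]; then on [A] each column takes values in an interval of
    length [5/2 delta], up to measure [2 th]. If a set of rows and a set of columns
    are both good, chaining two such intervals shows that [f] is within [5 delta] of
    a constant on their product, up to few pairs.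

    Stability bounds the height of a binary tree of such splittings. Hence a set
    that is not good can be trimmed by removing pieces of lower rank. Iterating
    with thresholds [th] that decrease fast enough, there is a bounded stage at
    which the trimming removes little measure; the pieces removed before that
    stage are decomposed by induction on the rank, and those removed at that stage
    become exceptional. This makes the final pieces good for a threshold as small
    as desired in terms of their number. Rows and columns are treated at once, as
    subsets of [V + W]. *)
Require Import Defs.
From HB Require Import structures.
From mathcomp Require Import all_boot all_order all_algebra.
From mathcomp Require Import boolp reals.
From mathcomp Require Import lra.

Set Implicit Arguments.
Unset Strict Implicit.
Unset Printing Implicit Defensive.

Import Order.TTheory GRing.Theory Num.Theory.
Local Open Scope ring_scope.

(** * Ranks of sets with respect to families of splittings *)

(* Not [ranked d A] means that some full binary tree of height [d] of splittings
   by tests in [P] has all its [2 ^ d] branches realised in [A]. *)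
Fixpoint ranked (U : finType) (I : Type) (Lo Hi : I -> {set U})
    (P : I -> Prop) (d : nat) (A : {set U}) : Prop :=
  if d is d'.+1 then
    forall i, P i -> ranked Lo Hi P d' (A :&: Lo i) \/
                     ranked Lo Hi P d' (A :&: Hi i)
  else A = set0.

Section Ranked.
Variables (U : finType) (I : Type) (Lo Hi : I -> {set U}).
Implicit Types (P Q : I -> Prop) (A B : {set U}).

Lemma ranked_set0 P d : ranked Lo Hi P d set0.
Proof. by elim: d => [//|d IH] i _; left; rewrite set0I. Qed.

Lemma ranked_subset P d A B :
  A \subset B -> ranked Lo Hi P d B -> ranked Lo Hi P d A.
Proof.
elim: d A B => [|d IH] A B sAB /=.
  by move=> B0; apply/eqP; rewrite -subset0 -B0.
by move=> rB i Pi; case: (rB i Pi) => r; [left|right]; apply: IH r; apply: setSI.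
Qed.

Lemma ranked_weaken P Q d A :
  (forall i, Q i -> P i) -> ranked Lo Hi P d A -> ranked Lo Hi Q d A.
Proof.
move=> QP; elim: d A => [//|d IH] A rA i Qi.
by case: (rA i (QP i Qi)) => r; [left|right]; exact: IH.
Qed.

(** A Ramsey property of trees. A test in [P] passes to a side where the [P]-rank drops while the
    [Q]-rank is inherited by the subset, and symmetrically; so each level of the tree uses up one
    unit of [d + e]. *)
Lemma ranked_or P Q d e A : ranked Lo Hi P d A -> ranked Lo Hi Q e A ->
  ranked Lo Hi (fun i => P i \/ Q i) (d + e) A.
Proof.
have [n] := ubnP (d + e); elim: n d e A => // n IH [|d] [|e] A lt_n rP rQ.
- exact: rP.
- by rewrite (rP : A = set0); apply: ranked_set0.
- by rewrite (rQ : A = set0); apply: ranked_set0.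
have sI (B : {set U}) : A :&: B \subset A by apply: subsetIl.
rewrite addSn => i [Pi|Qi].
- by case: (rP i Pi) => r; [left|right]; apply: IH => //; apply: ranked_subset rQ.
- rewrite -addSnnS.
  by case: (rQ i Qi) => r; [left|right]; apply: (IH d.+1 e);
    rewrite ?addSnnS //; apply: ranked_subset rP.
Qed.

(** Iterates [ranked_or] over the [g] classes. The successor serves [g = 0]: no test is then
    allowed, so every set has rank 1, but only the empty set has rank 0. *)
Lemma ranked_exists (P : nat -> I -> Prop) g d A :
  (forall u, (u < g)%N -> ranked Lo Hi (P u) d A) ->
  ranked Lo Hi (fun i => exists2 u, (u < g)%N & P u i) (g * d).+1 A.
Proof.
elim: g => [|g IH] rA; first by move=> i [].
rewrite mulSn -addnS.
apply: (@ranked_weaken (fun i => P g i \/ exists2 u, (u < g)%N & P u i)).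
  move=> i [u]; rewrite ltnS leq_eqVlt => /orP[/eqP->|ltu] Pu; first by left.
  by right; exists u.
by apply: ranked_or; [apply: rA | apply: IH => u ltu; apply: rA; apply: ltnW].
Qed.

End Ranked.

(** One level is lost because [A] may contain points outside the image of [h]: when its preimage is
    empty, [A] need not be, but it misses [h @: lo i], so one further test empties it. *)
Lemma ranked_transport (X U : finType) (K J : Type) (lo hi : K -> {set X})
    (Lo Hi : J -> {set U}) (P : J -> Prop) (h : X -> U) d (A : {set U}) :
  (forall j, P j -> exists i, Lo j = h @: lo i /\ Hi j = h @: hi i) ->
  injective h ->
  ranked lo hi (fun=> True) d (h @^-1: A) -> ranked Lo Hi P d.+1 A.
Proof.
move=> LH h_inj; elim: d A => [|d IH] A.
  move=> /= A0 j Pj; left; have [i [-> _]] := LH j Pj.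
  apply/setP=> y; rewrite !inE; apply/negP=> /andP[yA /imsetP[x _ yx]].
  by move/setP: A0 => /(_ x); rewrite !inE -yx yA.
have pre (B : {set X}) : h @^-1: (A :&: h @: B) = h @^-1: A :&: B.
  by apply/setP=> x; rewrite !inE mem_imset.
move=> rA j Pj; have [i [LoE HiE]] := LH j Pj.
by case: (rA i I) => r; [left|right]; apply: IH; rewrite ?LoE ?HiE pre.
Qed.

(** * Stability bounds the rank *)

Section StableRank.
Variables (R : realType) (delta : R).
Hypothesis delta_gt0 : 0 < delta.
Variables (X Y : finType) (f : X -> Y -> R).
Hypothesis f01 : forall x y, 0 <= f x y <= 1.

Definition below (i : Y * R) : {set X} := [set x | f x i.1 <= i.2].
Definition above (i : Y * R) : {set X} :=
  [set x | i.2 + 5 / 2 * delta <= f x i.1].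

Definition crossing (p q : X * Y) : bool :=
  delta <= `|f p.1 q.2 - f q.1 p.2|.

(** The inner successor pays for the root of the subtree; the factor [g] and the outer successor are
    the cost in [ranked_exists] of restricting to one of [g] strips of values. *)
Fixpoint rank_bound (g k : nat) : nat :=
  if k is k'.+1 then (g * (rank_bound g k').+1).+1 else 0.

(* Choose a row [c] and a large subtree on whose columns [f c] is constant up to
   [delta / 2]; this constant is [delta] away from one of the two sides of the root
   [b] of the subtree, since these are [5/2 delta] apart. Then [(c, b)] crosses all
   the pairs found on that side. Either order of the two values is allowed, so the
   pairs need not be rearranged into a half-graph. *)
Lemma crossing_seq (g k : nat) (A : {set X}) (Q : {set Y}) :
  1 < g%:R * (delta / 2) ->
  ~ ranked below above (fun i => i.1 \in Q) (rank_bound g k) A ->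
  exists s : seq (X * Y), [/\ size s = k, pairwise crossing s
    & all (fun p => (p.1 \in A) && (p.2 \in Q)) s].
Proof.
move=> hg; elim: k A Q => [|k IH] A Q nr; first by exists [::].
have [A0|[c cA]] := set_0Vmem A.
  by case: nr; rewrite A0; apply: ranked_set0.
pose w := delta / 2; have w_gt0 : 0 < w by rewrite /w divr_gt0.
pose C u := [set y in Q | u%:R * w <= f c y <= u.+1%:R * w].
have [u ltu nru] : exists2 u, (u < g)%N &
    ~ ranked below above (fun i => i.1 \in C u) (rank_bound g k).+1 A.
  apply: contrapT => nex; apply: nr.
  have := @ranked_exists _ _ below above (fun u i => i.1 \in C u) g
    (rank_bound g k).+1 A.
  move=> H; apply: ranked_weaken (H _); last first.
    by move=> u ltu; apply: contrapT => nru; apply: nex; exists u.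
  move=> [y s] /= yQ; have /andP[fy0 fy1] := f01 c y.
  have qge0 : 0 <= f c y / w by rewrite divr_ge0 // ltW.
  have /andP[t1 t2] := truncn_itv qge0.
  exists (Num.truncn (f c y / w)).
    rewrite -(ltr_nat R); apply: le_lt_trans t1 _.
    by rewrite ltr_pdivrMr //; apply: le_lt_trans fy1 hg.
  by rewrite inE yQ /= -ler_pdivlMr // t1 -ler_pdivrMr // ltW.
have {nru} [[b s] bC nrb] : exists2 i, i.1 \in C u &
    ~ (ranked below above (fun i => i.1 \in C u) (rank_bound g k) (A :&: below i)
    \/ ranked below above (fun i => i.1 \in C u) (rank_bound g k) (A :&: above i)).
  apply: contrapT => nex; apply: nru => i Ci.
  by apply: contrapT => ni; apply: nex; exists i.
have bQ : b \in Q by move: bC; rewrite /= inE => /andP[].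
have [B [sBA farB nrB]] : exists B : {set X}, [/\ B \subset A,
    forall a y, a \in B -> y \in C u -> delta <= `|f c y - f a b|
    & ~ ranked below above (fun i => i.1 \in C u) (rank_bound g k) B].
  have uw y : y \in C u -> u%:R * w <= f c y <= u%:R * w + w.
    by rewrite inE -natr1 mulrDl mul1r => /andP[].
  (* In the first case the lower side is [delta] under the strip. In the second, [s + 5/2 delta]
     exceeds [u * w + 3/2 delta], which is [delta] over the top of the strip, as [w = delta / 2]. *)
  have [ls|ls] := lerP (s + delta) (u%:R * w).
    exists (A :&: below (b, s)); split; [exact: subsetIl | | tauto].
    move=> a y /setIP[_]; rewrite inE /= => fa /uw /andP[fc _].
    by apply: le_trans (ler_norm _); lra.
  exists (A :&: above (b, s)); split; [exact: subsetIl | | tauto].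
  move=> a y /setIP[_]; rewrite inE /= => fa /uw /andP[_ fc].
  by rewrite distrC; apply: le_trans (ler_norm _); rewrite /w in ls fc *; lra.
have [t [st pt /allP at_]] := IH B (C u) nrB.
have inC y : y \in C u -> y \in Q by rewrite inE => /andP[].
exists ((c, b) :: t); split; first by rewrite /= st.
- rewrite pairwise_cons pt andbT; apply/allP => p /at_ /andP[pB pC].
  exact: farB.
- rewrite /= cA bQ /=; apply/allP => p /at_ /andP[pB pC].
  by rewrite (subsetP sBA) // inC.
Qed.

Lemma stable_ranked (g k : nat) :
  1 < g%:R * (delta / 2) ->
  ~ (exists (a : 'I_k -> X) (b : 'I_k -> Y), forall i j : 'I_k, (i < j)%N ->
        delta <= `|f (a i) (b j) - f (a j) (b i)|) ->
  ranked below above (fun=> True) (rank_bound g k) setT.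
Proof.
move=> hg st; apply: contrapT => nr; apply: st.
have [s [ss ps _]] : exists s : seq (X * Y), [/\ size s = k, pairwise crossing s
    & all (fun p => (p.1 \in setT) && (p.2 \in setT)) s].
  apply: (@crossing_seq g) => // r; apply: nr; apply: ranked_weaken r.
  by move=> i _; rewrite inE.
have szs (i : 'I_k) : (i < size s)%N by rewrite ss.
pose t (i : 'I_k) := tnth (in_tuple s) (cast_ord (esym ss) i).
exists (fun i => (t i).1), (fun i => (t i).2) => i j ltij.
have x0 := t i.
have tE l : t l = nth x0 s l by rewrite /t (tnth_nth x0).
rewrite !tE; move/(pairwiseP x0): ps => /(_ i j).
by rewrite !inE ss => /(_ (ltn_ord i) (ltn_ord j) ltij).
Qed.

End StableRank.

(** * Decomposition into good sets *)

Record content (R : realType) (U : finType) (mu : {set U} -> R) : Prop := {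
  content_ge0 : forall A, 0 <= mu A;
  content_split : forall A B, mu A = mu (A :&: B) + mu (A :\: B) }.

Definition good (R : realType) (U : finType) (I : Type) (Lo Hi : I -> {set U})
    (mu : {set U} -> R) (th : R) (A : {set U}) : Prop :=
  forall i, mu (A :&: Lo i) < th \/ mu (A :&: Hi i) < th.

(** The members of [s] may overlap, so this only bounds the content of [cov s]; it is the potential
    that trimming decreases. *)
Definition total (R : realType) (U : finType) (mu : {set U} -> R)
  (s : seq {set U}) : R := \sum_(A <- s) mu A.

Definition cov (U : finType) (s : seq {set U}) : {set U} := \bigcup_(A <- s) A.

Section Content.
Variables (R : realType) (U : finType) (mu : {set U} -> R).
Hypothesis mu_content : content mu.
Implicit Types (A B Z : {set U}) (s : seq {set U}).

Lemma content_le A B : A \subset B -> mu A <= mu B.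
Proof.
move=> sAB; rewrite (content_split mu_content B A) (setIidPr sAB).
by rewrite lerDl content_ge0.
Qed.

Lemma contentU_le A B : mu (A :|: B) <= mu A + mu B.
Proof.
rewrite (content_split mu_content (A :|: B) A) setUK lerD2l content_le //.
by rewrite setDUl setDv set0U subsetDl.
Qed.

Lemma content_set0 : mu set0 = 0.
Proof.
by have /eqP := content_split mu_content set0 set0;
  rewrite setI0 setD0 -subr_eq0 opprD addNKr oppr_eq0 => /eqP.
Qed.

Lemma content_total_ge0 s : 0 <= total mu s.
Proof. by apply: sumr_ge0 => A _; apply: content_ge0. Qed.

Lemma content_cov s : mu (cov s) <= total mu s.
Proof.
rewrite /cov /total; elim: s => [|A s IH].
  by rewrite !big_nil content_set0.
by rewrite !big_cons; apply: le_trans (contentU_le _ _) _; rewrite lerD2l.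
Qed.

Lemma total_le_size s (K : R) : mu setT <= K -> total mu s <= (size s)%:R * K.
Proof.
move=> hK; rewrite /total; elim: s => [|A s IH].
  by rewrite big_nil mul0r.
rewrite big_cons /= -natr1 mulrDl mul1r addrC lerD //.
by apply: le_trans hK; apply: content_le; apply: subsetT.
Qed.

Variables (J : Type) (Lo Hi : J -> {set U}).

Lemma good_subset th A B : A \subset B -> good Lo Hi mu th B -> good Lo Hi mu th A.
Proof.
move=> sAB gB i; case: (gB i) => g; [left|right]; apply: le_lt_trans g;
  by apply: content_le; apply: setSI.
Qed.

Lemma good_le th th' A : th <= th' -> good Lo Hi mu th A -> good Lo Hi mu th' A.
Proof. by move=> le gA i; case: (gA i) => g; [left|right]; apply: lt_le_trans le. Qed.

Local Notation rk := (ranked Lo Hi (fun=> True)).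

(** While [A] is not good, some test has two sides of content at least [th], and one of them has
    rank [d]: remove it and repeat. Every removal costs at least [th], which bounds the number of
    pieces removed. *)
Lemma trim (d : nat) (th : R) A : 0 < th -> rk d.+1 A ->
  exists (A' : {set U}) (r : seq {set U}),
  [/\ rk d.+1 A', good Lo Hi mu th A', (forall B, B \in r -> rk d B),
      A \subset A' :|: cov r &
      total mu r <= mu A - mu A' /\ (size r)%:R * th <= mu A - mu A'].
Proof.
move=> th_gt0; have [n] := ubnP #|A|; elim: n A => // n IH A leAn rA.
have [gA|] := pselect (good Lo Hi mu th A).
  by exists A, [::]; rewrite /total /cov !big_nil mul0r subrr setU0.
move=> /existsNP[i /not_orP[/negP]]; rewrite -leNgt => mLo /negP.
rewrite -leNgt => mHi.
have [B [sBA mB rB]] : exists B, [/\ B \subset A, th <= mu B & rk d B].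
  by case: (rA i I) => r; [exists (A :&: Lo i)|exists (A :&: Hi i)];
    rewrite subsetIl.
have muA : mu A = mu B + mu (A :\: B).
  by rewrite (content_split mu_content A B) (setIidPr sBA).
have [||A' [r [rA' gA' rr cA' [t1 t2]]]] := IH (A :\: B).
- have B0 : (0 < #|B|)%N.
    rewrite lt0n cards_eq0; apply: contraTneq (lt_le_trans th_gt0 mB) => ->.
    by rewrite content_set0 ltxx.
  rewrite cardsD (setIidPr sBA) -ltnS; apply: leq_trans leAn.
  by rewrite ltnS -subn_gt0 subKn ?subset_leq_card.
- by apply: ranked_subset rA; apply: subsetDl.
exists A', (B :: r); split => //.
- by move=> C; rewrite inE => /orP[/eqP->//|]; apply: rr.
- rewrite /cov big_cons setUCA; apply/subsetP=> x xA; rewrite inE.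
  have [//|/= xB] := boolP (x \in B).
  by apply: (subsetP cA'); rewrite inE xB.
rewrite /total big_cons /= -natr1 mulrDl mul1r muA -!addrA.
split; first by rewrite lerD2l.
by rewrite addrC lerD.
Qed.

Lemma trim_seq (d : nat) (th : R) s : 0 < th ->
  (forall A, A \in s -> rk d.+1 A) ->
  exists s' r : seq {set U},
  [/\ size s' = size s,
      (forall A, A \in s' -> rk d.+1 A /\ good Lo Hi mu th A),
      (forall A, A \in r -> rk d A),
      cov s \subset cov s' :|: cov r
    & total mu r <= total mu s - total mu s' /\
      (size r)%:R * th <= total mu s - total mu s'].
Proof.
move=> th_gt0; rewrite /total /cov; elim: s => [|A s IH] rs.
  by exists [::], [::]; split=> //; rewrite !big_nil ?sub0set // mul0r subrr.
have [A' [r [rA' gA' rr cA' [t1 t2]]]] := trim th_gt0 (rs A (mem_head _ _)).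
have [B Bs|s' [q [sz rs' rq cs [u1 u2]]]] := IH.
  by apply: rs; rewrite inE Bs orbT.
exists (A' :: s'), (r ++ q); split=> /=; first by rewrite sz.
- by move=> B; rewrite inE => /orP[/eqP->|]; [split|apply: rs'].
- by move=> B; rewrite mem_cat => /orP[]; [apply: rr|apply: rq].
- rewrite big_cat !big_cons /= setUACA; exact: setUSS.
rewrite big_cat !big_cons size_cat natrD /= mulrDl opprD addrACA.
by split; apply: lerD.
Qed.

End Content.

Section Partition.
Variables (R : realType) (K : R).

(** [N] is uniform in the space, the tests and the content, whereas the threshold depends on the
    number of pieces actually obtained, so that it can be made small compared with that number. *)
Definition decomposes (d t : nat) (eta : R) (F : nat -> R) (N : nat) : Prop :=
  forall (U : finType) (J : Type) (Lo Hi : J -> {set U}) (mu : {set U} -> R)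
    (s : seq {set U}),
  content mu -> mu setT <= K -> (size s <= t)%N ->
  (forall A, A \in s -> ranked Lo Hi (fun=> True) d A) ->
  exists (s' : seq {set U}) (Z : {set U}),
  [/\ (size s' <= N)%N, (forall A, A \in s' -> good Lo Hi mu (F (size s')) A),
      mu Z <= eta & cov s \subset cov s' :|: Z].

(* Trim [s] at the threshold [F (N1 + t)], where [N1] bounds the size of a
   decomposition of [r0]. Either the trimming removes at most [eta], and then
   what it removed joins the exceptional set, or [total mu s] drops by [eta],
   which can happen at most [q] times. *)
Lemma decomposes_stage (d : nat) (F : nat -> R) (eta : R) :
  0 < eta -> (forall n, 0 < F n) -> {homo F : m n / (m <= n)%N >-> n <= m} ->
  (forall t (F' : nat -> R), (forall n, 0 < F' n) ->
     {homo F' : m n / (m <= n)%N >-> n <= m} ->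
     exists N, decomposes d t eta F' N) ->
  forall q t t0 : nat, exists N : nat,
  forall (U : finType) (J : Type) (Lo Hi : J -> {set U}) (mu : {set U} -> R)
    (s r0 : seq {set U}),
  content mu -> mu setT <= K -> (size s <= t)%N -> (size r0 <= t0)%N ->
  (forall A, A \in s -> ranked Lo Hi (fun=> True) d.+1 A) ->
  (forall A, A \in r0 -> ranked Lo Hi (fun=> True) d A) ->
  total mu s <= q%:R * eta ->
  exists (s' : seq {set U}) (Z : {set U}),
  [/\ (size s' <= N)%N, (forall A, A \in s' -> good Lo Hi mu (F (size s')) A),
      mu Z <= eta + eta & cov s :|: cov r0 \subset cov s' :|: Z].
Proof.
move=> eta_gt0 F_gt0 F_anti IHd; elim=> [|q IHq] t t0.
  have [N dec] := IHd t0 F F_gt0 F_anti.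
  exists N => U J Lo Hi mu s r0 cmu muK ss sr0 rs rr0; rewrite mul0r => tot0.
  have [s' [Z [ss' gs' muZ cs']]] := dec _ _ _ _ _ _ cmu muK sr0 rr0.
  exists s', (cov s :|: Z); split=> //.
    apply: le_trans (contentU_le cmu _ _) _; apply: lerD => //.
    apply: le_trans (content_cov cmu s) _.
    by apply: le_trans tot0 _; apply: ltW.
  by rewrite setUCA; apply: setUS.
(* The final family will also contain the at most [t] trimmed sets, hence the shift of [F]. *)
have [N1 dec] := IHd t0 (fun m => F (m + t)%N) (fun m => F_gt0 _)
  (fun m n le => F_anti _ _ (leq_add le (leqnn t))).
pose th := F (N1 + t)%N; have th_gt0 : 0 < th := F_gt0 _.
(* A bound on the number of removed pieces: each accounts for [th] of a total of at most
   [q.+1 * eta]. *)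
pose c := (Num.truncn (q.+1%:R * eta / th)).+1.
have [N2 stg] := IHq t (c + t0)%N.
exists (maxn (N1 + t) N2) => U J Lo Hi mu s r0 cmu muK ss sr0 rs rr0 tot.
have [s1 [r [ss1 rs1 rr cs [t1 t2]]]] := trim_seq cmu th_gt0 rs.
have [small|large] := lerP (total mu s - total mu s1) eta.
  have [s' [Z [ss' gs' muZ cs']]] := dec _ _ _ _ _ _ cmu muK sr0 rr0.
  exists (s1 ++ s'), (cov r :|: Z); split.
  - by rewrite size_cat ss1 leq_max addnC leq_add.
  - move=> A; rewrite size_cat mem_cat => /orP[/rs1[_]|/gs']; apply: good_le.
      by apply: F_anti; rewrite addnC leq_add // ss1.
    by apply: F_anti; rewrite addnC leq_add2l ss1.
  - apply: le_trans (contentU_le cmu _ _) _; apply: lerD => //.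
    apply: le_trans (content_cov cmu r) _.
    exact: le_trans t1 _.
  - by rewrite /cov big_cat /= setUACA; apply: setUSS.
have [|||||s' [Z [ss' gs' muZ cs']]] := stg U J Lo Hi mu s1 (r ++ r0) cmu muK.
- by rewrite ss1.
- rewrite size_cat leq_add // -(ler_nat R) /c.
  apply: le_trans (ltW (truncnS_gt _)).
  rewrite ler_pdivlMr //; apply: le_trans t2 _.
  by apply: le_trans tot; rewrite gerBl content_total_ge0.
- by move=> A /rs1[].
- by move=> A; rewrite mem_cat => /orP[]; [apply: rr|apply: rr0].
- by move: tot large; rewrite -natr1 mulrDl mul1r; lra.
exists s', Z; split=> //; first by rewrite leq_max ss' orbT.
apply: subset_trans cs'; rewrite /cov big_cat /= setUA.
exact: setSU.
Qed.

Lemma decomposition (d t : nat) (eta : R) (F : nat -> R) :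
  0 < eta -> (forall n, 0 < F n) -> {homo F : m n / (m <= n)%N >-> n <= m} ->
  exists N, decomposes d t eta F N.
Proof.
elim: d t eta F => [|d IH] t eta F eta_gt0 F_gt0 F_anti.
  exists 0%N => U J Lo Hi mu s cmu muK _ rs; exists [::], set0; split => //.
    by rewrite content_set0 // ltW.
  apply/subsetP=> x; rewrite /cov big_nil setU0 bigcup_seq => /bigcupP[A As].
  by rewrite (rs A As : A = set0).
have eta2_gt0 : 0 < eta / 2 by rewrite divr_gt0.
(* The initial total is at most [t * K], so [q] drops of [eta / 2] exhaust it; halving [eta]
   compensates for the two exceptional sets of [decomposes_stage]. *)
pose q := (Num.truncn (t%:R * `|K| / (eta / 2))).+1.
have [N dec] := decomposes_stage eta2_gt0 F_gt0 F_anti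
  (fun t F' h1 h2 => IH t _ F' eta2_gt0 h1 h2) q t 0.
exists N => U J Lo Hi mu s cmu muK ss rs.
have [||||s' [Z [ss' gs' muZ cs']]] := dec U J Lo Hi mu s [::] cmu muK ss => //.
  apply: le_trans (total_le_size cmu s muK) _.
  apply: (@le_trans _ _ (t%:R * `|K|)).
    apply: (@le_trans _ _ ((size s)%:R * `|K|)).
      by rewrite ler_wpM2l ?ler_norm.
    by rewrite ler_wpM2r // ler_nat.
  by rewrite -ler_pdivrMr //; apply: ltW (truncnS_gt _).
exists s', Z; split=> //; first by rewrite [leRHS]splitr.
by apply: subset_trans cs'; apply: subsetUl.
Qed.

End Partition.

(** * Products of good sets *)

Lemma card_fst_fibers (V W : finType) (E : {set V * W}) :
  #|E| = (\sum_(v : V) #|[set w | (v, w) \in E]|)%N.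
Proof.
rewrite -sum1_card big_mkcond (eq_bigr (fun p => if (p.1, p.2) \in E then 1 else 0)%N).
  rewrite -(pair_bigA _ (fun v w => if (v, w) \in E then 1 else 0)%N) /=.
  apply: eq_bigr => v _; rewrite -big_mkcond -sum1_card.
  by apply: eq_bigl => w; rewrite inE.
by case.
Qed.

Lemma card_snd_fibers (V W : finType) (E : {set V * W}) :
  #|E| = (\sum_(w : W) #|[set v | (v, w) \in E]|)%N.
Proof.
rewrite -sum1_card big_mkcond (eq_bigr (fun p => if (p.1, p.2) \in E then 1 else 0)%N).
  rewrite -(pair_bigA _ (fun v w => if (v, w) \in E then 1 else 0)%N) exchange_big /=.
  apply: eq_bigr => v _; rewrite -big_mkcond -sum1_card.
  by apply: eq_bigl => w; rewrite inE.
by case.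
Qed.

Definition counting (R : realType) (X : finType) (A : {set X}) : R := #|A|%:R.

Definition far (R : realType) (X Y : finType) (delta : R) (f : X -> Y -> R)
    (A : {set X}) (y : Y) (t : R) : {set X} :=
  [set x in A | ~~ (t <= f x y <= t + 5 / 2 * delta)].

Section Interval.
Variables (R : realType) (X Y : finType).

(* [t] is the least value taken on [A] whose sublevel set has at least [c]
   elements, or [1] if there is none. *)
Lemma good_interval (delta c : R) (f : X -> Y -> R) (A : {set X}) (y : Y) :
  0 < delta -> (forall x y, 0 <= f x y <= 1) -> 0 < c ->
  good (below f) (above delta f) (@counting R X) c A ->
  exists t, 0 <= t <= 1 /\ #|far delta f A y t|%:R <= 2 * c.
Proof.
move=> delta_gt0 f01 c_gt0 gA.
pose P x := (x \in A) && (c <= #|A :&: below f (y, f x y)|%:R).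
(* The largest value below [t] taken on [A] has all of [[set x in A | f x y < t]] in its sublevel
   set, and it fails [P]. *)
have small t : (forall x, f x y < t -> ~~ P x) ->
    #|[set x in A | f x y < t]|%:R < c.
  move=> nP; have [->|[x0 x0B]] := set_0Vmem [set x in A | f x y < t].
    by rewrite cards0.
  case: (arg_maxP (f ^~ y) x0B) => x xB xmax.
  have /setIdP[xA xt] : x \in [set x in A | f x y < t] := xB.
  have := nP x xt; rewrite /P xA /= -ltNge; apply: le_lt_trans.
  rewrite ler_nat; apply: subset_leq_card; apply/subsetP=> z zB.
  have fzx : f z y <= f x y := xmax z zB.
  by rewrite !inE fzx andbT; case/setIdP: zB.
have split_far t : #|far delta f A y t|%:R <=
    #|[set x in A | f x y < t]|%:R + #|A :&: above delta f (y, t)|%:R :> R.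
  rewrite -natrD ler_nat; apply: leq_trans (leq_card_setU _ _).
  apply: subset_leq_card; apply/subsetP=> x; rewrite !inE negb_and -!ltNge.
  by move=> /andP[-> /orP[->//|/ltW ->]]; rewrite orbT.
have [x0 Px0|noP] := pickP P.
  case: (arg_minP (f ^~ y) Px0) => x /andP[xA cx] xmin.
  exists (f x y); split; first exact: f01.
  apply: le_trans (split_far _) _.
  have /ltW h1 : #|[set z in A | f z y < f x y]|%:R < c.
    apply: small => z ltz; apply/negP => Pz.
    by have := xmin z Pz; rewrite leNgt ltz.
  case: (gA (y, f x y)) => [|/ltW h2]; first by rewrite ltNge cx.
  by move: h1 h2; rewrite /counting; lra.
exists 1; split; first by rewrite ler01 lexx.
apply: le_trans (split_far _) _.
have /ltW h1 : #|[set z in A | f z y < 1]|%:R < c by apply: small => z _; rewrite noP.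
have -> : A :&: above delta f (y, 1) = set0.
  apply/setP=> x; rewrite !inE /=; apply/negP=> /andP[_ h].
  have /andP[_ h'] := f01 x y; lra.
by rewrite cards0; lra.
Qed.

End Interval.

Section Pair.
Variables (R : realType) (V W : finType) (delta : R) (f : V -> W -> R).

Definition far_cell (A : {set V}) (B : {set W}) (r : R) : {set V * W} :=
  [set p in setX A B | 5 * delta < `|f p.1 p.2 - r|].

(* Choosing [a0] in few exceptional pairs, [f a b] is close to [f a0 b] through
   the interval of [b], which is close to [up a0] through the interval of [a0]. *)
Lemma far_cell_le (A : {set V}) (B : {set W}) (lo : W -> R) (up : V -> R) :
  (forall a, 0 <= up a <= 1) ->
  exists2 r, 0 <= r <= 1 & (#|far_cell A B r| <=
    2 * (\sum_(b : W) #|far delta f A b (lo b)| +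
         \sum_(a : V) #|far delta (fun w v => f v w) B a (up a)|))%N.
Proof.
move=> up01.
pose E1 := [set p in setX A B | p.1 \in far delta f A p.2 (lo p.2)].
pose E2 := [set p in setX A B |
  p.2 \in far delta (fun w v => f v w) B p.1 (up p.1)].
pose e a := #|[set b | (a, b) \in E1 :|: E2]|.
have leE : (#|E1 :|: E2| <= \sum_(b : W) #|far delta f A b (lo b)| +
         \sum_(a : V) #|far delta (fun w v => f v w) B a (up a)|)%N.
  apply: leq_trans (leq_card_setU _ _) _; apply: leq_add.
    rewrite card_snd_fibers; apply: leq_sum => b _; apply: subset_leq_card.
    by apply/subsetP=> a; rewrite inE inE => /andP[].
  rewrite card_fst_fibers; apply: leq_sum => a _; apply: subset_leq_card.
  by apply/subsetP=> b; rewrite inE inE => /andP[].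
have [A0|[a1 a1A]] := set_0Vmem A.
  exists 0; first by rewrite lexx ler01.
  have -> : far_cell A B 0 = set0.
    by apply/setP=> -[a b]; rewrite !inE A0 inE.
  by rewrite cards0.
have [a0 a0A a0min] : exists2 a0, a0 \in A & forall a, a \in A -> (e a0 <= e a)%N.
  by case: (arg_minnP e a1A) => a0; exists a0.
exists (up a0); first exact: up01.
apply: leq_trans (leq_mul (leqnn 2) leE); rewrite mul2n -addnn.
(* Since [a0] minimises [e], the pairs [(a, b)] with [b] exceptional for [a0] are no more numerous
   than the exceptional pairs; they account for the second half of the factor 2. *)
have avg : (#|A| * e a0 <= #|E1 :|: E2|)%N.
  rewrite card_fst_fibers -sum_nat_const [leqRHS](bigID (mem A)) /=.
  by apply: leq_trans (leq_addr _ _); apply: leq_sum => a /a0min.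
apply: (@leq_trans (#|E1 :|: E2| + #|A| * e a0)); last by rewrite leq_add2l.
rewrite -cardsX; apply: leq_trans (leq_card_setU _ _).
apply: subset_leq_card; apply/subsetP=> -[a b].
rewrite inE in_setX /= => /andP[/andP[aA bB] big].
apply: contraLR big; rewrite in_setU in_setX aA /= !inE /= aA a0A bB /= -leNgt.
rewrite !negb_or !negbK => /andP[/andP[/andP[h1 h2] _]].
move=> /andP[/andP[h3 h4] /andP[h5 h6]].
by rewrite ler_norml; apply/andP; split; lra.
Qed.

(** Each column has at most [2 * th * #|V|] far rows and each row at most [2 * th * #|W|] far
    columns; adding up and doubling by [far_cell_le] gives the constant 8. *)
Lemma good_pair (A : {set V}) (B : {set W}) (th : R) :
  0 < delta -> 0 < th -> (0 < #|V|)%N -> (0 < #|W|)%N ->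
  (forall v w, 0 <= f v w <= 1) ->
  good (below f) (above delta f) (@counting R V) (th * #|V|%:R) A ->
  good (below (fun w v => f v w)) (above delta (fun w v => f v w))
    (@counting R W) (th * #|W|%:R) B ->
  exists2 r, 0 <= r <= 1 &
    #|far_cell A B r|%:R <= 8 * th * (#|V|%:R * #|W|%:R).
Proof.
move=> delta_gt0 th_gt0 V_gt0 W_gt0 f01 gA gB.
have cV : 0 < th * #|V|%:R by rewrite mulr_gt0 // ltr0n.
have cW : 0 < th * #|W|%:R by rewrite mulr_gt0 // ltr0n.
have [lo hlo] := choice (fun b => good_interval b delta_gt0 f01 cV gA).
have [up hup] :=
  choice (fun a => good_interval a delta_gt0 (fun x y => f01 y x) cW gB).
have [r r01 hr] := far_cell_le A B lo (fun a => (hup a).1).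
exists r => //; apply: (@le_trans _ _ (2 * (\sum_(b : W) 2 * (th * #|V|%:R) +
    \sum_(a : V) 2 * (th * #|W|%:R)))); last first.
  have sumc (T : finType) (x : R) : \sum_(i : T) x = #|T|%:R * x.
    by rewrite sumr_const mulr_natl.
  by rewrite !sumc; lra.
move: hr; rewrite -(ler_nat R) natrM natrD !natr_sum => /le_trans; apply.
rewrite ler_pM2l //; apply: lerD; apply: ler_sum => x _.
  exact: (hlo x).2.
exact: (hup x).2.
Qed.
End Pair.

(** * Simultaneous decomposition of rows and columns *)

Lemma stable_partition (R : realType) (delta eta : R) (k : nat) (F : nat -> R) :
  0 < delta -> 0 < eta -> (forall n, 0 < F n) ->
  {homo F : m n / (m <= n)%N >-> n <= m} ->
  exists N, forall (V W : finType) (f : V -> W -> R),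
  (0 < #|V|)%N -> (0 < #|W|)%N -> (forall v w, 0 <= f v w <= 1) ->
  stable k delta (fun p => f p.1 p.2) ->
  exists (As : seq {set V}) (Bs : seq {set W}) (M : nat),
  [/\ size As = M, size Bs = M, (M <= N)%N,
    (forall A, A \in As ->
       good (below f) (above delta f) (@counting R V) (F M * #|V|%:R) A) /\
    (forall B, B \in Bs ->
       good (below (fun w v => f v w)) (above delta (fun w v => f v w))
         (@counting R W) (F M * #|W|%:R) B)
   & #|~: cov As|%:R <= eta * #|V|%:R /\ #|~: cov Bs|%:R <= eta * #|W|%:R].
Proof.
move=> delta_gt0 eta_gt0 F_gt0 F_anti.
have d2 : 0 < delta / 2 by rewrite divr_gt0.
pose g := (Num.truncn (1 / (delta / 2))).+1.
have hg : 1 < g%:R * (delta / 2) by rewrite -ltr_pdivrMr // truncnS_gt.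
pose D := rank_bound g k.
(* The only initial set is all of [V + W], of content at most 2, one for each side. The rank is the
   sum of those of the two sides, each raised by one in [ranked_transport]. A single run gives both
   sides the same number [M] of pieces, hence the same threshold. *)
have [N dec] := @decomposition R 2 (D.+1 + D.+1) 1 eta F eta_gt0 F_gt0 F_anti.
exists N => V W f V_gt0 W_gt0 f01 st.
pose fT w v := f v w.
have rV : ranked (below f) (above delta f) (fun=> True) D setT.
  exact: stable_ranked.
have rW : ranked (below fT) (above delta fT) (fun=> True) D setT.
  apply: (stable_ranked delta_gt0 (fun w v => f01 v w) hg) => -[b [a ab]].
  apply: st.
  by exists a, b => i j /ab; rewrite /fT distrC.
pose J := (W * R + V * R)%type.
pose Lo (j : J) : {set V + W} :=
  match j with inl i => inl @: below f i | inr i => inr @: below fT i end.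
pose Hi (j : J) : {set V + W} :=
  match j with inl i => inl @: above delta f i | inr i => inr @: above delta fT i end.
pose isl (j : J) := if j is inl _ then True else False.
pose isr (j : J) := if j is inr _ then True else False.
have rU : ranked Lo Hi (fun=> True) (D.+1 + D.+1) setT.
  apply: (@ranked_weaken _ _ _ _ (fun j => isl j \/ isr j)).
    by case=> i _; [left|right].
  apply: ranked_or.
    apply: (@ranked_transport _ _ _ _ (below f) (above delta f) _ _ _ inl).
    - by case=> // i _; exists i.
    - by move=> x y [].
    - by rewrite preimsetT.
  apply: (@ranked_transport _ _ _ _ (below fT) (above delta fT) _ _ _ inr).
  - by case=> // i _; exists i.
  - by move=> x y [].
  - by rewrite preimsetT.
(* Each side is normalised separately, so that a set small for [mu] has small proportion in both [V]
   and [W]. *)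
pose mu (A : {set V + W}) : R :=
  #|inl @^-1: A|%:R / #|V|%:R + #|inr @^-1: A|%:R / #|W|%:R.
have cV : 0 < #|V|%:R :> R by rewrite ltr0n.
have cW : 0 < #|W|%:R :> R by rewrite ltr0n.
have cmu : content mu.
  split=> [A|A B]; first by rewrite addr_ge0 // divr_ge0 // ltW.
  rewrite /mu !preimsetI !preimsetD addrACA -!mulrDl -!natrD.
  by rewrite !cardsID.
have muT : mu setT <= 2.
  by rewrite /mu !preimsetT !cardsT !divff ?gt_eqF.
have mul (A : {set V + W}) : #|inl @^-1: A|%:R <= mu A * #|V|%:R.
  by rewrite -ler_pdivrMr // lerDl divr_ge0 // ltW.
have mur (A : {set V + W}) : #|inr @^-1: A|%:R <= mu A * #|W|%:R.
  by rewrite -ler_pdivrMr // lerDr divr_ge0 // ltW.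
have cutl (A : {set V + W}) (B : {set V}) th : mu (A :&: inl @: B) < th ->
    counting R (inl @^-1: A :&: B) < th * #|V|%:R.
  rewrite -(ltr_pM2r cV); apply: le_lt_trans; apply: le_trans (mul _).
  rewrite ler_nat; apply: subset_leq_card; apply/subsetP=> x.
  by rewrite !inE => /andP[-> xB]; rewrite imset_f.
have cutr (A : {set V + W}) (B : {set W}) th : mu (A :&: inr @: B) < th ->
    counting R (inr @^-1: A :&: B) < th * #|W|%:R.
  rewrite -(ltr_pM2r cW); apply: le_lt_trans; apply: le_trans (mur _).
  rewrite ler_nat; apply: subset_leq_card; apply/subsetP=> x.
  by rewrite !inE => /andP[-> xB]; rewrite imset_f.
have [A|s [Z [sN gs muZ cs]]] := dec _ _ Lo Hi mu [:: setT] cmu muT (leqnn 1).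
  by rewrite inE => /eqP->.
exists [seq inl @^-1: A | A : {set V + W} <- s].
exists [seq inr @^-1: A | A : {set V + W} <- s], (size s).
split; rewrite ?size_map //.
  split=> B /mapP[A /gs gA ->] i.
    by case: (gA (inl i)) => h; [left|right]; apply: cutl h.
  by case: (gA (inr i)) => h; [left|right]; apply: cutr h.
have covZ x : x \notin cov s -> x \in Z.
  move=> xs; have : x \in cov [:: setT] by rewrite /cov big_seq1.
  by move/(subsetP cs); rewrite inE (negbTE xs).
split.
  apply: le_trans (_ : mu Z * #|V|%:R <= _); last by rewrite ler_pM2r.
  apply: le_trans (mul _); rewrite ler_nat; apply: subset_leq_card.
  apply/subsetP=> x; rewrite !inE => h; apply: covZ; apply: contra h.
  rewrite /cov !bigcup_seq => /bigcupP[A As xA]; apply/bigcupP.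
  by exists (inl @^-1: A); rewrite ?map_f // inE.
apply: le_trans (_ : mu Z * #|W|%:R <= _); last by rewrite ler_pM2r.
apply: le_trans (mur _); rewrite ler_nat; apply: subset_leq_card.
apply/subsetP=> x; rewrite !inE => h; apply: covZ; apply: contra h.
rewrite /cov !bigcup_seq => /bigcupP[A As xA]; apply/bigcupP.
by exists (inr @^-1: A); rewrite ?map_f // inE.
Qed.

(** * Structured functions from labellings *)

Lemma card_preim_partition (V : finType) (c : V -> nat) (M : nat) :
  (0 < #|V|)%N -> (forall v, (c v <= M)%N) ->
  (0 < #|preim_partition c [set: V]| <= M.+1)%N.
Proof.
move=> V_gt0 cM; apply/andP; split.
  have [v _] := (card_gt0P V_gt0); rewrite card_gt0; apply/set0Pn.
  exists (pblock (preim_partition c setT) v); apply: pblock_mem.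
  by rewrite (cover_partition (preim_partitionP c setT)) inE.
rewrite -[M.+1]card_ord.
apply: leq_trans (leq_imset_card (fun l : 'I_M.+1 => [set v | c v == l]) _).
apply: subset_leq_card; apply/subsetP=> A /imsetP[v _ ->]; apply/imsetP.
exists (inord (c v)) => //; apply/setP=> w; rewrite !inE inordK ?ltnS // eq_sym.
Qed.

(** The pieces are the fibres of the labels. As pieces must be nonempty, [m] and [n] count the
    labels attained, minus one, and are only bounded by [M]. *)
Lemma structured_labels (R : realType) (V W : finType) (c : V -> nat)
    (e : W -> nat) (M : nat) (H : nat -> nat -> R) :
  (0 < #|V|)%N -> (0 < #|W|)%N ->
  (forall v, (c v <= M)%N) -> (forall w, (e w <= M)%N) ->
  (forall i j, -1 <= H i j <= 1) ->
  exists m n, [/\ (m <= M)%N, (n <= M)%N &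
    structured m n (fun p : V * W => H (c p.1) (e p.2))].
Proof.
move=> V_gt0 W_gt0 cM eM H1.
have PV := preim_partitionP c [set: V]; have PW := preim_partitionP e [set: W].
have := card_preim_partition V_gt0 cM; have := card_preim_partition W_gt0 eM.
set P := preim_partition c _ in PV *; set Q := preim_partition e _ in PW *.
move=> /andP[Q_gt0 QM] /andP[P_gt0 PM].
exists #|P|.-1, #|Q|.-1; split; [by rewrite -ltnS prednK | by rewrite -ltnS prednK |].
split=> [p|]; first exact: H1.
(* Recovers the common label of a piece; the default 0 is reached only on the empty set. *)
pose lab (X : finType) (c : X -> nat) (A : {set X}) :=
  if [pick x in A] is Some x then c x else 0%N.
have labE (X : finType) (u : X -> nat) (A : {set X}) x :
    A \in preim_partition u setT -> x \in A -> lab X u A = u x.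
  move=> /imsetP[y _ ->]; rewrite !inE /= => /eqP uxy; rewrite /lab.
  case: pickP => [z|/(_ y)]; last by rewrite !inE eqxx.
  by rewrite !inE /= -uxy => /eqP.
have single (X : finType) (T : {set {set X}}) (x : X) (G : {set X} -> R) :
    partition T setT -> \sum_(A in T) G A * (x \in A)%:R = G (pblock T x).
  move=> pT; have xT : x \in cover T by rewrite (cover_partition pT) inE.
  rewrite (bigD1 (pblock T x)) ?pblock_mem //= mem_pblock xT mulr1.
  rewrite big1 ?addr0 // => A /andP[AT]; apply: contraNeq => nz.
  have xA : x \in A by apply: contraNT nz => /negbTE->; rewrite mulr0.
  by rewrite (def_pblock (partition_trivIset pT) AT xA).
exists P, Q, (fun A B => H (lab V c A) (lab W e B)); split.
- by rewrite prednK.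
- by rewrite prednK.
- by move=> A B _ _; apply: H1.
move=> [v w] /=.
have vP : v \in cover P by rewrite (cover_partition PV) inE.
have wQ : w \in cover Q by rewrite (cover_partition PW) inE.
rewrite -(labE V c (pblock P v) v) ?pblock_mem ?mem_pblock //.
rewrite -(labE W e (pblock Q w) w) ?pblock_mem ?mem_pblock //.
rewrite -(single _ P v (fun A => H (lab V c A) (lab W e (pblock Q w)))) //.
apply: eq_bigr => A _.
rewrite -(single _ Q w (fun B => H (lab V c A) (lab W e B))) // big_distrl /=.
by apply: eq_bigr => B _; rewrite in_setX /= -mulnb natrM mulrA mulrAC.
Qed.

(** * Assembling the decomposition *)

(** A nonincreasing positive minorant of [sigma]: the thresholds of the decomposition must be
    nonincreasing, while [sigma] is arbitrary. *)
Fixpoint running_min (R : realType) (sigma : nat -> R) (n : nat) : R :=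
  if n is n'.+1 then Num.min (running_min sigma n') (sigma n) else sigma 0%N.

Lemma running_min_gt0 (R : realType) (sigma : nat -> R) n :
  (forall t, 0 < sigma t) -> 0 < running_min sigma n.
Proof. by move=> s0; elim: n => //= n IH; rewrite lt_min IH s0. Qed.

Lemma running_min_anti (R : realType) (sigma : nat -> R) :
  {homo running_min sigma : m n / (m <= n)%N >-> n <= m}.
Proof.
move=> m n; elim: n => [|n IH]; first by rewrite leqn0 => /eqP->.
rewrite leq_eqVlt => /orP[/eqP->//|le_mn] /=.
by rewrite ge_min IH.
Qed.

Lemma running_min_le (R : realType) (sigma : nat -> R) m n :
  (m <= n)%N -> running_min sigma n <= sigma m.
Proof.
move/(running_min_anti sigma)/le_trans; apply.
by case: m => //= m; rewrite ge_min lexx orbT.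
Qed.

Lemma leq_card_bigcup (T X : finType) (E : T -> {set X}) :
  (#|\bigcup_(i : T) E i| <= \sum_(i : T) #|E i|)%N.
Proof.
elim/big_rec2: _ => [|i y1 y2 _ le]; first by rewrite cards0.
by apply: leq_trans (leq_card_setU _ _) _; rewrite leq_add2l.
Qed.

Theorem theorem6p8 (R : realType) (k : nat) (delta eps : R) (sigma : nat -> R)
    (hk : (1 <= k)%N) (hdelta : 0 < delta) (heps : 0 < eps)
    (hsigma : forall t : nat, 0 < sigma t < 1) :
  exists N : nat,
    forall (V W : finType) (f : V * W -> R),
      (0 < #|V|)%N -> (0 < #|W|)%N ->
      valued_in 0 1 f -> stable k delta f ->
      exists (m n : nat) (fstr fpsd ferr : V * W -> R),
        [/\ (m <= N)%N /\ (n <= N)%N,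
            f =1 fstr \+ fpsd \+ ferr,
            [/\ approx_structured (5%:R * delta + eps) m n fstr,
                #|support fpsd|%:R <= sigma (m * n)%N * #|{: V * W}|%:R
              & structured_support eps ferr],
            [/\ valued_in (-1) 1 fpsd, valued_in 0 1 fstr & valued_in 0 1 ferr]
          & inner ferr fstr = 0 /\ inner ferr (fun x => `|fpsd x|) = 0].
Proof.
have sigma_gt0 t : 0 < sigma t by case/andP: (hsigma t).
(* There will be [M * M] regular cells, each with a proportion of at most [8 * F M] far pairs, which
   add up to at most [sigma (m * n)] as [m, n <= M]. The successor keeps the denominator nonzero. *)
pose F n := running_min sigma (n * n) / (8 * (n * n).+1%:R).
have den_gt0 n : 0 < 8 * (n * n).+1%:R :> R by rewrite mulr_gt0 ?ltr0n.
have F_gt0 n : 0 < F n by rewrite divr_gt0 ?running_min_gt0.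
have F_anti : {homo F : m n / (m <= n)%N >-> n <= m}.
  move=> m n le; apply: ler_pM.
  - exact/ltW/running_min_gt0.
  - by rewrite invr_ge0 ltW.
  - by apply: running_min_anti; apply: leq_mul.
  by rewrite lef_pV2 ?posrE // ler_pM2l // ler_nat ltnS leq_mul.
have [N part] := stable_partition k hdelta heps F_gt0 F_anti.
exists N => V W f V_gt0 W_gt0 f01 st.
pose g v w := f (v, w); have g01 v w : 0 <= g v w <= 1 := f01 (v, w).
have stg : stable k delta (fun p => g p.1 p.2).
  by move=> [a [b ab]]; apply: st; exists a, b => i j /ab.
have [As [Bs [M [sA sB MN [gA gB] [cA cB]]]]] := part V W g V_gt0 W_gt0 g01 stg.
(* Labelling a point by the first set containing it makes the cells disjoint. Uncovered points get
   the label [size s], which is that of the exceptional piece. *)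
pose lab (X : finType) (s : seq {set X}) x := find (fun A : {set X} => x \in A) s.
pose cell (X : finType) (s : seq {set X}) i := [set x | lab X s x == i].
have cell_sub (X : finType) (s : seq {set X}) i :
    (i < size s)%N -> cell X s i \subset nth set0 s i.
  move=> lti; apply/subsetP=> x; rewrite inE => /eqP xi.
  by rewrite -xi; apply: (nth_find _ (a := fun A : {set X} => x \in A));
    rewrite has_find -/(lab X s x) xi.
have lab_cov (X : finType) (s : seq {set X}) x :
    ~~ (lab X s x < size s)%N -> x \in ~: cov s.
  rewrite -has_find inE; apply: contra; rewrite /cov bigcup_seq.
  by move=> /bigcupP[A As' xA]; apply/hasP; exists A.
have cvX (X : finType) : content (@counting R X).
  by split=> [A|A B]; rewrite /counting ?ler0n // -natrD cardsID.
(* Only labels below [M] are constrained, so that [h] can be chosen on all pairs of naturals. *)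
pose fits (q : nat * nat) (r : R) := 0 <= r <= 1 /\
  ((q.1 < M)%N -> (q.2 < M)%N ->
   #|far_cell delta g (cell V As q.1) (cell W Bs q.2) r|%:R <=
     8 * F M * (#|V|%:R * #|W|%:R)).
have [h hP] : {h : nat * nat -> R & forall q, fits q (h q)}.
  apply: choice => -[i j]; rewrite /fits /=.
  have [lti|nlti] := ltnP i M; last first.
    by exists 0; rewrite lexx ler01; split.
  have [ltj|nltj] := ltnP j M; last first.
    by exists 0; rewrite lexx ler01; split.
  have gAi : good (below g) (above delta g) (@counting R V) (F M * #|V|%:R)
      (cell V As i).
    apply: good_subset (gA _ (mem_nth set0 (_ : (i < size As)%N))) => //;
      by rewrite ?sA ?cell_sub ?sA.
  have gBj : good (below (fun w v => g v w)) (above delta (fun w v => g v w))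
      (@counting R W) (F M * #|W|%:R) (cell W Bs j).
    apply: good_subset (gB _ (mem_nth set0 (_ : (j < size Bs)%N))) => //;
      by rewrite ?sB ?cell_sub ?sB.
  have [r r01 hr] := good_pair hdelta (F_gt0 M) V_gt0 W_gt0 g01 gAi gBj.
  by exists r; split.
pose c := lab V As; pose e := lab W Bs.
pose H i j := if (i < M)%N && (j < M)%N then h (i, j) else 0.
have H01 i j : 0 <= H i j <= 1.
  by rewrite /H; case: ifP => _; [case: (hP (i, j))|rewrite lexx ler01].
pose hh (p : V * W) := H (c p.1) (e p.2).
have cM v : (c v <= M)%N by rewrite -sA find_size.
have eM w : (e w <= M)%N by rewrite -sB find_size.
have H1 i j : -1 <= H i j <= 1 by have := H01 i j; lra.
have [m [n [mM nM str]]] := structured_labels V_gt0 W_gt0 cM eM H1.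
pose reg p := (c p.1 < M)%N && (e p.2 < M)%N.
pose bad p := reg p && (5 * delta < `|f p - hh p|).
(* On regular pairs [f] is kept where it is close to the cell constant and replaced by that constant
   elsewhere, the difference going to [fpsd]. The other pairs are left to [ferr], whose support is
   thus disjoint from those of [fstr] and [fpsd]; this gives the orthogonality. *)
pose fstr p := if reg p then if bad p then hh p else f p else 0.
pose fpsd p := if bad p then f p - hh p else 0.
pose ferr p := if reg p then 0 else f p.
have hh01 p : 0 <= hh p <= 1 by exact: H01.
have str01 : valued_in 0 1 fstr.
  move=> p; rewrite /fstr; case: ifP => _; last by rewrite lexx ler01.
  by case: ifP => _; [exact: hh01 | exact: f01].
have err01 : valued_in 0 1 ferr.
  by move=> p; rewrite /ferr; case: ifP => _; [rewrite lexx ler01|exact: f01].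
have near p : `|fstr p - hh p| <= 5 * delta.
  rewrite /fstr; case: ifP => regp; last first.
    by rewrite /hh /H -/(reg p) regp subrr normr0; lra.
  case: ifPn; first by rewrite subrr normr0; lra.
  by rewrite /bad regp -leNgt.
exists m, n, fstr, fpsd, ferr; split.
- by split; [apply: leq_trans mM MN|apply: leq_trans nM MN].
- move=> p /=; rewrite /fstr /fpsd /ferr /bad.
  by case: (reg p) => /=; [case: ifP => _|]; lra.
- split.
  + split=> //; exists hh; split=> //.
    apply/bigmax_leP; split=> [|p _]; first by lra.
    by apply: le_trans (near p) _; lra.
  + apply: (@le_trans _ _ (\sum_(q : 'I_M * 'I_M) 8 * F M * (#|V|%:R * #|W|%:R))).
      apply: (@le_trans _ _ (\sum_(q : 'I_M * 'I_M)
          #|far_cell delta g (cell V As q.1) (cell W Bs q.2) (h (q.1 : nat, q.2 : nat))|%:R)).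
        rewrite -natr_sum ler_nat; apply: leq_trans (leq_card_bigcup _).
        apply: subset_leq_card; apply/subsetP=> -[v w].
        rewrite inE /fpsd; case: ifP => [/andP[/andP[cv ew] big] _|]; last by rewrite eqxx.
        apply/bigcupP; exists (Ordinal cv, Ordinal ew) => //.
        by move: big; rewrite !inE !eqxx /= /hh /H cv ew.
      by apply: ler_sum => -[i j] _ /=; apply: (hP (i : nat, j : nat)).2 => /=.
    have -> x : \sum_(q : 'I_M * 'I_M) x = (M * M)%:R * x :> R.
      by rewrite sumr_const card_prod card_ord mulr_natl.
    rewrite card_prod (natrM _ #|V|) mulrA.
    rewrite ler_wpM2r ?mulr_ge0 ?ler0n //.
    apply: (@le_trans _ _ (running_min sigma (M * M))); last first.
      by apply: running_min_le; apply: leq_mul.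
    have -> : running_min sigma (M * M) = 8 * (M * M).+1%:R * F M.
      by rewrite /F mulrC divfK // gt_eqF.
    rewrite mulrA [_ * 8]mulrC ler_pM2r // ler_pM2l // ler_nat.
    exact: leqnSn.
  + split; first by move=> p; have := err01 p; lra.
    exists (~: cov As), (~: cov Bs); split=> //.
    apply/subsetP=> -[v w]; rewrite inE /ferr /reg in_setU !in_setX !in_setT andbT.
    case: ifPn => [_|]; first by rewrite eqxx.
    by rewrite negb_and => /orP[] h' _; apply/orP; [left|right];
      apply: lab_cov; rewrite ?sA ?sB.
- split=> // p; rewrite /fpsd; case: ifP => _; last by rewrite oppr_le0 !ler01.
  by have := f01 p; have := hh01 p; lra.
- split; rewrite /inner big1 ?mulr0 // => p _; rewrite /ferr /fstr /fpsd /bad;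
  by case: (reg p); rewrite /= ?normr0 ?mul0r ?mulr0.
Qed.
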